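(* Let $k$ be a field and let $A$ be a finite-dimensional $k$-algebra. If $E_1$ is an injective left $A$-module and $E_2$ is an injective right $A$-module, then $E_1\otimes E_2$ is an injective left $A^e$-module.
   Context: $\otimes=\otimes_k$, $A^e=A\otimes A^{\mathrm{op}}$, and $E_1\otimes E_2$ is a left $A^e$-module (equivalently an $A$-bimodule) via $(a\otimes a')(x\otimes y)=ax\otimes ya'$. *)

(* Defs.v *)
From HB Require Import structures.
From mathcomp Require Import all_boot all_order all_algebra all_field.
From mathcomp Require Import boolp.

Set Implicit Arguments.
Unset Strict Implicit.
Unset Printing Implicit Defensive.

Import GRing.Theory.
Local Open Scope ring_scope.
Local Open Scope quotient_scope.

(* A k-algebra is a ring A with a ring morphism from k to its centre.          *)
(* MathComp's algType and falgType additionally require 1 != 0 in A.           *)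
HB.mixin Record isKAlgebra (k : fieldType) A of GRing.PzRing A := {
  alg_scalar : {rmorphism k -> A};
  alg_scalarC : forall (c : k) (a : A), alg_scalar c * a = a * alg_scalar c
}.

#[short(type="kalgType")]
HB.structure Definition KAlgebra (k : fieldType) :=
  {A of GRing.PzRing A & isKAlgebra k A}.

Arguments alg_scalar {k} A : rename.

Section Opposite.
Variables (k : fieldType) (A : kalgType k).

Definition opp_scalar (c : k) : A^c := alg_scalar A c.

Fact opp_scalar_zmod_morphism : zmod_morphism opp_scalar.
Proof. exact: (rmorphB (alg_scalar A)). Qed.

Fact opp_scalar_monoid_morphism : monoid_morphism opp_scalar.
Proof.
split=> [|c d]; first exact: (rmorph1 (alg_scalar A)).
by rewrite /opp_scalar mulrC; apply: (rmorphM (alg_scalar A)).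
Qed.

HB.instance Definition _ :=
  GRing.isZmodMorphism.Build k A^c opp_scalar opp_scalar_zmod_morphism.
HB.instance Definition _ :=
  GRing.isMonoidMorphism.Build k A^c opp_scalar opp_scalar_monoid_morphism.

Fact opp_scalarC (c : k) (a : A^c) : opp_scalar c * a = a * opp_scalar c.
Proof. exact: (esym (alg_scalarC c (a : A))). Qed.

HB.instance Definition _ := isKAlgebra.Build k A^c opp_scalarC.

End Opposite.

(* The k-vector space underlying a module over a k-algebra. *)
Section RestrictScalars.
Variables (k : fieldType) (A : kalgType k) (E : lmodType A).

Definition kspace : Type := E.

HB.instance Definition _ := GRing.Zmodule.on kspace.

Definition kspace_scale (c : k) (x : kspace) : kspace :=
  alg_scalar A c *: (x : E).

Fact kspace_scaleA c d x :
  kspace_scale c (kspace_scale d x) = kspace_scale (c * d) x.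
Proof. by rewrite /kspace_scale scalerA -rmorphM. Qed.

Fact kspace_scale1 : left_id 1 kspace_scale.
Proof. by move=> x; rewrite /kspace_scale rmorph1 scale1r. Qed.

Fact kspace_scaleDr : right_distributive kspace_scale +%R.
Proof. by move=> c x y; apply: (@scalerDr A E). Qed.

Fact kspace_scaleDl x : {morph kspace_scale^~ x : c d / c + d}.
Proof. by move=> c d; rewrite /kspace_scale rmorphD; apply: (@scalerDl A E). Qed.

HB.instance Definition _ := GRing.Zmodule_isLmodule.Build k kspace
  kspace_scaleA kspace_scale1 kspace_scaleDr kspace_scaleDl.

Lemma kspace_scaleE (c : k) (x : kspace) : c *: x = alg_scalar A c *: (x : E).
Proof. by []. Qed.

End RestrictScalars.

Arguments kspace {k} A E.

Definition finite_dimensional (k : fieldType) (V : lmodType k) : Prop :=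
  exists (n : nat) (f : {linear V -> 'rV[k]_n}), bijective f.

(* [tensor V W] is the commutative monoid of formal sums of pairs (x, y),      *)
(* represented as lists, modulo the congruence generated by the bilinearity    *)
(* relations.  The relation [(0, y) ~ 0] is needed because formal sums are not *)
(* assumed to cancel; opposites are then given by - (x, y) = (- x, y).         *)
Section TensorEq.
Variables (k : fieldType) (V W : lmodType k).
Implicit Types (s t : seq (V * W)).

Inductive tensor_eq : seq (V * W) -> seq (V * W) -> Prop :=
| TensorRefl s : tensor_eq s s
| TensorSym s t : tensor_eq s t -> tensor_eq t s
| TensorTrans s t u : tensor_eq s t -> tensor_eq t u -> tensor_eq s u
| TensorCat s s' t t' :
    tensor_eq s s' -> tensor_eq t t' -> tensor_eq (s ++ t) (s' ++ t')
| TensorComm s t : tensor_eq (s ++ t) (t ++ s)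
| TensorZero y : tensor_eq [:: (0, y)] [::]
| TensorAddl x x' y : tensor_eq [:: (x + x', y)] [:: (x, y); (x', y)]
| TensorAddr x y y' : tensor_eq [:: (x, y + y')] [:: (x, y); (x, y')]
| TensorScale c x y : tensor_eq [:: (c *: x, y)] [:: (x, c *: y)].

Definition tensor_eqb : rel (seq (V * W)) := fun s t => `[< tensor_eq s t >].

Fact tensor_eqb_equiv : equiv_class_of tensor_eqb.
Proof.
split=> [s|s t|t s u].
- exact/asboolP/TensorRefl.
- by apply/asboolP/asboolP => /TensorSym.
- by move=> /asboolP st /asboolP tu; apply/asboolP/(TensorTrans st tu).
Qed.

Canonical tensor_equiv := EquivRelPack tensor_eqb_equiv.

Definition tensor : Type := {eq_quot tensor_equiv}.

HB.instance Definition _ := Choice.on tensor.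
HB.instance Definition _ := EqQuotient.on tensor.

Lemma tensor_piP s t : tensor_eq s t <-> \pi_tensor s = \pi_tensor t.
Proof.
split=> [st|]; first by apply/eqmodP/asboolP.
by move/eqmodP/asboolP.
Qed.

Lemma tensor_quotW (P : tensor -> Prop) :
  (forall s, P (\pi_tensor s)) -> forall u, P u.
Proof. by move=> Ppi u; rewrite -[u]reprK. Qed.

Definition tensor_add (u v : tensor) : tensor := \pi_tensor (repr u ++ repr v).

Lemma pi_tensor_add s t :
  tensor_add (\pi_tensor s) (\pi_tensor t) = \pi_tensor (s ++ t).
Proof. by apply/tensor_piP/TensorCat; apply/tensor_piP; rewrite reprK. Qed.

Fact tensor_addA : associative tensor_add.
Proof.
elim/tensor_quotW=> s; elim/tensor_quotW=> t; elim/tensor_quotW=> u.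
by rewrite !pi_tensor_add catA.
Qed.

Fact tensor_addC : commutative tensor_add.
Proof.
elim/tensor_quotW=> s; elim/tensor_quotW=> t; rewrite !pi_tensor_add.
exact/tensor_piP/TensorComm.
Qed.

Fact tensor_add0 : left_id (\pi_tensor [::]) tensor_add.
Proof. by elim/tensor_quotW=> s; rewrite pi_tensor_add. Qed.

HB.instance Definition _ :=
  GRing.isNmodule.Build tensor tensor_addA tensor_addC tensor_add0.

Definition pure (x : V) (y : W) : tensor := \pi_tensor [:: (x, y)].

Lemma pi_tensorE s : \pi_tensor s = \sum_(p <- s) pure p.1 p.2.
Proof.
elim: s => [|[x y] s IHs]; first by rewrite big_nil.
by rewrite big_cons -IHs /= -[RHS]/(tensor_add _ _) pi_tensor_add.
Qed.

Lemma tensor_ind (P : tensor -> Prop) :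
    P 0 -> (forall x y, P (pure x y)) ->
    (forall u v, P u -> P v -> P (u + v)) ->
  forall u, P u.
Proof.
move=> P0 Pp PD; elim/tensor_quotW=> s; rewrite pi_tensorE.
by elim: s => [|p s IHs]; rewrite ?big_nil ?big_cons //; apply: PD.
Qed.

Lemma pure0l y : pure 0 y = 0.
Proof. exact/tensor_piP/TensorZero. Qed.

Lemma pureDl x x' y : pure (x + x') y = pure x y + pure x' y.
Proof. by rewrite -[RHS]/(tensor_add _ _) pi_tensor_add; apply/tensor_piP/TensorAddl. Qed.

Lemma pureDr x y y' : pure x (y + y') = pure x y + pure x y'.
Proof. by rewrite -[RHS]/(tensor_add _ _) pi_tensor_add; apply/tensor_piP/TensorAddr. Qed.

Lemma pureZ c x y : pure (c *: x) y = pure x (c *: y).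
Proof. exact/tensor_piP/TensorScale. Qed.

Lemma pure0r x : pure x 0 = 0.
Proof. by rewrite -(scale0r 0) -pureZ scale0r pure0l. Qed.

(* Universal property. *)
Record balanced (Z : nmodType) (f : V -> W -> Z) : Prop := Balanced {
  balanced0l : forall y, f 0 y = 0;
  balancedDl : forall x x' y, f (x + x') y = f x y + f x' y;
  balancedDr : forall x y y', f x (y + y') = f x y + f x y';
  balancedZ : forall c x y, f (c *: x) y = f x (c *: y)
}.

Definition tensor_lift (Z : nmodType) (f : V -> W -> Z) (u : tensor) : Z :=
  \sum_(p <- repr u) f p.1 p.2.

Lemma tensor_lift_pi (Z : nmodType) (f : V -> W -> Z) s : balanced f ->
  tensor_lift f (\pi_tensor s) = \sum_(p <- s) f p.1 p.2.
Proof.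
move=> [f0 fDl fDr fZ]; rewrite /tensor_lift.
have: tensor_eq (repr (\pi_tensor s)) s by apply/tensor_piP; rewrite reprK.
move: (repr _) => r; elim=> {r s} //=.
- by move=> s t u _ -> _ ->.
- by move=> s s' t t' _ Es _ Et; rewrite !big_cat /= Es Et.
- by move=> s t; rewrite !big_cat /= addrC.
- by move=> y; rewrite big_seq1 big_nil /= f0.
- by move=> x x' y; rewrite !big_cons !big_nil !addr0 /= fDl.
- by move=> x y y'; rewrite !big_cons !big_nil !addr0 /= fDr.
- by move=> c x y; rewrite !big_seq1 /= fZ.
Qed.

Lemma tensor_lift_pure (Z : nmodType) (f : V -> W -> Z) x y : balanced f ->
  tensor_lift f (pure x y) = f x y.
Proof. by move=> bf; rewrite tensor_lift_pi // big_seq1. Qed.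

Lemma tensor_lift0 (Z : nmodType) (f : V -> W -> Z) : balanced f ->
  tensor_lift f 0 = 0.
Proof. by move=> bf; rewrite -[0]/(\pi_tensor [::]) tensor_lift_pi // big_nil. Qed.

Lemma tensor_liftD (Z : nmodType) (f : V -> W -> Z) u v : balanced f ->
  tensor_lift f (u + v) = tensor_lift f u + tensor_lift f v.
Proof.
move=> bf; elim/tensor_quotW: u => s; elim/tensor_quotW: v => t.
by rewrite -[_ + _]/(tensor_add _ _) pi_tensor_add !tensor_lift_pi // big_cat.
Qed.

Definition tensor_opp (u : tensor) : tensor :=
  tensor_lift (fun x y => pure (- x) y) u.

Fact tensor_opp_balanced : balanced (fun x y => pure (- x) y).
Proof.
split=> [y|x x' y|x y y'|c x y].
- by rewrite oppr0 pure0l.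
- by rewrite opprD pureDl.
- exact: pureDr.
- by rewrite -scalerN pureZ.
Qed.

Fact tensor_addN : left_inverse 0 tensor_opp +%R.
Proof.
elim/tensor_ind=> [|x y|u v IHu IHv].
- by rewrite addr0 /tensor_opp (tensor_lift0 tensor_opp_balanced).
- rewrite /tensor_opp (tensor_lift_pure _ _ tensor_opp_balanced).
  by rewrite -pureDl addNr pure0l.
- rewrite /tensor_opp (tensor_liftD _ _ tensor_opp_balanced) addrACA.
  by rewrite [X in X + _]IHu [X in _ + X]IHv addr0.
Qed.

HB.instance Definition _ := GRing.Nmodule_isZmodule.Build tensor tensor_addN.

Definition tensor_scale (c : k) (u : tensor) : tensor :=
  tensor_lift (fun x y => pure (c *: x) y) u.

Fact tensor_scale_balanced c : balanced (fun x y => pure (c *: x) y).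
Proof.
split=> [y|x x' y|x y y'|d x y].
- by rewrite scaler0 pure0l.
- by rewrite scalerDr pureDl.
- exact: pureDr.
- by rewrite scalerA mulrC -scalerA pureZ.
Qed.

Lemma tensor_scale_pure c x y : tensor_scale c (pure x y) = pure (c *: x) y.
Proof. exact: tensor_lift_pure (tensor_scale_balanced c). Qed.

Fact tensor_scale0 c : tensor_scale c 0 = 0.
Proof. exact: tensor_lift0 (tensor_scale_balanced c). Qed.

Fact tensor_scaleDr : right_distributive tensor_scale +%R.
Proof. by move=> c u v; apply: tensor_liftD (tensor_scale_balanced c). Qed.

Fact tensor_scaleA c d u :
  tensor_scale c (tensor_scale d u) = tensor_scale (c * d) u.
Proof.
elim/tensor_ind: u => [|x y|u v IHu IHv]; first by rewrite !tensor_scale0.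
  by rewrite !tensor_scale_pure scalerA.
by rewrite !tensor_scaleDr IHu IHv.
Qed.

Fact tensor_scale1 : left_id 1 tensor_scale.
Proof.
elim/tensor_ind=> [|x y|u v IHu IHv]; first by rewrite tensor_scale0.
  by rewrite tensor_scale_pure scale1r.
by rewrite tensor_scaleDr IHu IHv.
Qed.

Fact tensor_scaleDl u : {morph tensor_scale^~ u : c d / c + d}.
Proof.
move=> c d; elim/tensor_ind: u => [|x y|u v IHu IHv].
- by rewrite !tensor_scale0 addr0.
- by rewrite !tensor_scale_pure scalerDl pureDl.
- by rewrite !tensor_scaleDr IHu IHv addrACA.
Qed.

HB.instance Definition _ := GRing.Zmodule_isLmodule.Build k tensor
  tensor_scaleA tensor_scale1 tensor_scaleDr tensor_scaleDl.

Lemma pureZl c x y : pure (c *: x) y = c *: pure x y.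
Proof. by rewrite -[RHS]/(tensor_scale _ _) tensor_scale_pure. Qed.

Lemma pureZr c x y : pure x (c *: y) = c *: pure x y.
Proof. by rewrite -pureZ pureZl. Qed.

End TensorEq.

(* The library's algebras as instances of the structures above. *)
Section LibraryAlgebra.
Variables (k : fieldType) (A : algType k).

Definition kalg : Type := A.

HB.instance Definition _ := GRing.PzRing.on kalg.

Fact in_algC (c : k) (a : kalg) : in_alg A c * a = a * in_alg A c :> kalg.
Proof. exact: (etrans (mulr_algl c (a : A)) (esym (mulr_algr c (a : A)))). Qed.

HB.instance Definition _ := @isKAlgebra.Build k kalg (in_alg A) in_algC.

End LibraryAlgebra.

Lemma finite_dimensional_falgType (k : fieldType) (A : falgType k) :
  finite_dimensional (kspace (kalg A) (kalg A)^o).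
Proof.
pose f : kspace (kalg A) (kalg A)^o -> 'rV[k]_(dim A) :=
  @VectorInternalTheory.v2r k A.
have linf : linear f.
  have [v2rZ v2rD] := v2r_semilinear (VectorInternalTheory.v2r_subproof A).
  move=> c x y; rewrite /f /VectorInternalTheory.v2r v2rD; congr (_ + _).
  by rewrite -v2rZ; congr (v2r _ _); apply: (mulr_algl c (x : A)).
pose lf := GRing.isLinear.Build _ _ _ _ f linf.
pose g : {linear kspace (kalg A) (kalg A)^o -> 'rV[k]_(dim A)} :=
  HB.pack f lf.
exists (dim A), g; exists (@VectorInternalTheory.r2v k A).
- exact: (@VectorInternalTheory.v2rK k A).
- exact: (@VectorInternalTheory.r2vK k A).
Qed.

(* For an A-module E1 and a B-module E2, [tensor_module E1 E2] is E1 ⊗_k E2.   *)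
(* It is a separate name so that it can carry its A ⊗_k B-module structure;    *)
(* A ⊗_k B itself is [tensor_alg A B], with multiplication given by its action *)
(* on A ⊗_k B as a left module over itself.                                    *)
Section TensorAlgebra.
Variables (k : fieldType) (A B : kalgType k).

Definition tensor_alg : Type :=
  tensor (kspace A A^o) (kspace B B^o).

HB.instance Definition _ := GRing.Zmodule.on tensor_alg.

Definition apure (a : A) (b : B) : tensor_alg :=
  @pure k (kspace A A^o) (kspace B B^o) a b.

Lemma tensor_alg_ind (P : tensor_alg -> Prop) :
    P 0 -> (forall a b, P (apure a b)) ->
    (forall r s, P r -> P s -> P (r + s)) ->
  forall r, P r.
Proof. exact: (@tensor_ind k (kspace A A^o) (kspace B B^o) P). Qed.

Section Action.
Variables (E1 : lmodType A) (E2 : lmodType B).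

Definition tensor_module : Type := tensor (kspace A E1) (kspace B E2).

HB.instance Definition _ := GRing.Zmodule.on tensor_module.

Definition mpure (x : E1) (y : E2) : tensor_module :=
  @pure k (kspace A E1) (kspace B E2) x y.

Lemma tensor_module_ind (P : tensor_module -> Prop) :
    P 0 -> (forall x y, P (mpure x y)) ->
    (forall u v, P u -> P v -> P (u + v)) ->
  forall u, P u.
Proof. exact: (@tensor_ind k (kspace A E1) (kspace B E2) P). Qed.

(* (a ⊗ b)(x ⊗ y) = (a x) ⊗ (b y). *)
Definition tensor_act1 (a : A) (b : B) (u : tensor_module) : tensor_module :=
  @tensor_lift k (kspace A E1) (kspace B E2) tensor_module
    (fun (x : E1) (y : E2) => mpure (a *: x) (b *: y)) u.

Definition tensor_act (r : tensor_alg) (u : tensor_module) : tensor_module :=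
  @tensor_lift k (kspace A A^o) (kspace B B^o) tensor_module
    (fun (a : A) (b : B) => tensor_act1 a b u) r.

Fact tensor_act1_balanced (a : A) (b : B) :
  @balanced k (kspace A E1) (kspace B E2) tensor_module
    (fun (x : E1) (y : E2) => mpure (a *: x) (b *: y)).
Proof.
split=> [y|x x' y|x y y'|c x y].
- by rewrite (@scaler0 A E1); apply: pure0l.
- by rewrite (@scalerDr A E1); apply: pureDl.
- by rewrite (@scalerDr B E2); apply: pureDr.
- rewrite !kspace_scaleE !scalerA -!alg_scalarC -!scalerA.
  exact: (@pureZ k (kspace A E1) (kspace B E2)).
Qed.

Lemma tensor_act1_pure (a : A) (b : B) (x : E1) (y : E2) :
  tensor_act1 a b (mpure x y) = mpure (a *: x) (b *: y).
Proof. exact: tensor_lift_pure (tensor_act1_balanced a b). Qed.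

Lemma tensor_act1_0 (a : A) (b : B) : tensor_act1 a b 0 = 0.
Proof. exact: tensor_lift0 (tensor_act1_balanced a b). Qed.

Lemma tensor_act1D (a : A) (b : B) : {morph tensor_act1 a b : u v / u + v}.
Proof. by move=> u v; apply: tensor_liftD (tensor_act1_balanced a b). Qed.

Fact tensor_act_balanced (u : tensor_module) :
  @balanced k (kspace A A^o) (kspace B B^o) tensor_module
    (fun (a : A) (b : B) => tensor_act1 a b u).
Proof.
split=> [b|a a' b|a b b'|c a b]; elim/tensor_module_ind: u => [|x y|u v IHu IHv];
  rewrite ?tensor_act1_0 ?tensor_act1_pure ?tensor_act1D ?addr0 //.
- by rewrite (@scale0r A E1); apply: pure0l.
- by rewrite IHu IHv addr0.
- by rewrite (@scalerDl A E1); apply: pureDl.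
- by rewrite IHu IHv addrACA.
- by rewrite (@scalerDl B E2); apply: pureDr.
- by rewrite IHu IHv addrACA.
- rewrite -[LHS]/(mpure ((alg_scalar A c * a) *: x) (b *: y)).
  rewrite -[RHS]/(mpure (a *: x) ((alg_scalar B c * b) *: y)) -!scalerA.
  exact: (@pureZ k (kspace A E1) (kspace B E2)).
- by rewrite IHu IHv.
Qed.

Lemma tensor_act_pure1 (a : A) (b : B) (u : tensor_module) :
  tensor_act (apure a b) u = tensor_act1 a b u.
Proof. exact: tensor_lift_pure (tensor_act_balanced u). Qed.

Lemma tensor_act_pure (a : A) (b : B) (x : E1) (y : E2) :
  tensor_act (apure a b) (mpure x y) = mpure (a *: x) (b *: y).
Proof. by rewrite tensor_act_pure1 tensor_act1_pure. Qed.

Lemma tensor_act0l u : tensor_act 0 u = 0.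
Proof. exact: tensor_lift0 (tensor_act_balanced u). Qed.

Lemma tensor_actDl u : {morph tensor_act^~ u : r s / r + s}.
Proof. by move=> r s; apply: tensor_liftD (tensor_act_balanced u). Qed.

Lemma tensor_act0r r : tensor_act r 0 = 0.
Proof.
elim/tensor_alg_ind: r => [|a b|r s IHr IHs]; first exact: tensor_act0l.
  by rewrite tensor_act_pure1 tensor_act1_0.
by rewrite tensor_actDl IHr IHs addr0.
Qed.

Lemma tensor_actDr : right_distributive tensor_act +%R.
Proof.
move=> r u v; elim/tensor_alg_ind: r => [|a b|r s IHr IHs].
- by rewrite !tensor_act0l addr0.
- by rewrite !tensor_act_pure1 tensor_act1D.
- by rewrite !tensor_actDl IHr IHs addrACA.
Qed.

Lemma tensor_act_id : left_id (apure 1 1) tensor_act.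
Proof.
elim/tensor_module_ind=> [|x y|u v IHu IHv]; first by rewrite tensor_act0r.
  by rewrite tensor_act_pure !scale1r.
by rewrite tensor_actDr IHu IHv.
Qed.

End Action.

Definition tensor_mul : tensor_alg -> tensor_alg -> tensor_alg :=
  @tensor_act A^o B^o.

Lemma tensor_mul_pure (a a' : A) (b b' : B) :
  tensor_mul (apure a b) (apure a' b') = apure (a * a') (b * b').
Proof. exact: (@tensor_act_pure A^o B^o). Qed.

Lemma tensor_actA (E1 : lmodType A) (E2 : lmodType B) r s
    (u : tensor_module E1 E2) :
  tensor_act r (tensor_act s u) = tensor_act (tensor_mul r s) u.
Proof.
elim/tensor_alg_ind: r => [|a b|r r' IHr IHr'].
- by rewrite /tensor_mul !tensor_act0l.
- elim/tensor_alg_ind: s => [|a' b'|s s' IHs IHs'].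
  + by rewrite tensor_act0l tensor_act0r /tensor_mul tensor_act0r tensor_act0l.
  + elim/tensor_module_ind: u => [|x y|u v IHu IHv].
    * by rewrite !tensor_act0r.
    * by rewrite tensor_mul_pure !tensor_act_pure !scalerA.
    * by rewrite !tensor_actDr IHu IHv.
  + by rewrite /tensor_mul tensor_actDl !tensor_actDr IHs IHs' tensor_actDl.
- by rewrite /tensor_mul !tensor_actDl IHr IHr'.
Qed.

Fact tensor_mulA : associative tensor_mul.
Proof. by move=> r s t; apply: (@tensor_actA A^o B^o). Qed.

Fact tensor_mul1l : left_id (apure 1 1) tensor_mul.
Proof. exact: (@tensor_act_id A^o B^o). Qed.

Fact tensor_mul1r : right_id (apure 1 1) tensor_mul.
Proof.
elim/tensor_alg_ind=> [|a b|r s IHr IHs]; first exact: tensor_act0l.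
  by rewrite tensor_mul_pure !mulr1.
by rewrite /tensor_mul tensor_actDl; congr (_ + _).
Qed.

Fact tensor_mulDl : left_distributive tensor_mul +%R.
Proof. by move=> r s t; apply: tensor_actDl. Qed.

Fact tensor_mulDr : right_distributive tensor_mul +%R.
Proof. exact: (@tensor_actDr A^o B^o). Qed.

HB.instance Definition _ := GRing.Zmodule_isPzRing.Build tensor_alg
  tensor_mulA tensor_mul1l tensor_mul1r tensor_mulDl tensor_mulDr.

Lemma apureM (a a' : A) (b b' : B) :
  apure a b * apure a' b' = apure (a * a') (b * b').
Proof. exact: tensor_mul_pure. Qed.

Lemma apure11 : apure 1 1 = 1. Proof. by []. Qed.

Definition tensor_scalar (c : k) : tensor_alg := apure (alg_scalar A c) 1.

Fact tensor_scalar_zmod_morphism : zmod_morphism tensor_scalar.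
Proof.
move=> c d; apply/eqP; rewrite eq_sym subr_eq; apply/eqP.
rewrite /tensor_scalar rmorphB -[LHS]/(apure (alg_scalar A c) 1).
rewrite -[RHS](@pureDl k (kspace A A^o) (kspace B B^o)).
by rewrite -[X in pure X]/(alg_scalar A c - alg_scalar A d + alg_scalar A d) subrK.
Qed.

Fact tensor_scalar_monoid_morphism : monoid_morphism tensor_scalar.
Proof.
split=> [|c d]; first by rewrite /tensor_scalar rmorph1.
by rewrite /tensor_scalar apureM mulr1 rmorphM.
Qed.

HB.instance Definition _ := GRing.isZmodMorphism.Build k tensor_alg
  tensor_scalar tensor_scalar_zmod_morphism.
HB.instance Definition _ := GRing.isMonoidMorphism.Build k tensor_alg
  tensor_scalar tensor_scalar_monoid_morphism.

Fact tensor_scalarC (c : k) (r : tensor_alg) :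
  tensor_scalar c * r = r * tensor_scalar c.
Proof.
elim/tensor_alg_ind: r => [|a b|r s IHr IHs]; first by rewrite mulr0 mul0r.
  by rewrite /tensor_scalar !apureM mulr1 mul1r alg_scalarC.
by rewrite mulrDl mulrDr IHr IHs.
Qed.

HB.instance Definition _ := isKAlgebra.Build k tensor_alg tensor_scalarC.

End TensorAlgebra.

Section TensorModule.
Variables (k : fieldType) (A B : kalgType k).
Variables (E1 : lmodType A) (E2 : lmodType B).

HB.instance Definition _ :=
  GRing.Zmodule_isLmodule.Build (tensor_alg A B) (tensor_module E1 E2)
    (@tensor_actA k A B E1 E2) (@tensor_act_id k A B E1 E2)
    (@tensor_actDr k A B E1 E2) (@tensor_actDl k A B E1 E2).

Lemma scale_mpure (a : A) (b : B) (x : E1) (y : E2) :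
  apure a b *: mpure x y = mpure (a *: x) (b *: y).
Proof. exact: tensor_act_pure. Qed.

End TensorModule.

(* A right A-module is a left A^c-module, the product of y by a on the right   *)
(* being [(a : A^c) *: y].  Taking B = A^c, [scale_mpure] is then              *)
(* (a ⊗ a')(x ⊗ y) = a x ⊗ y a'.                                               *)
Notation rmodType A := (lmodType (A^c)%type).

Notation enveloping A := (tensor_alg A (A^c)%type).

Definition injective_module (R : pzRingType) (E : lmodType R) : Prop :=
  forall (X Y : lmodType R) (i : {linear X -> Y}) (f : {linear X -> E}),
    injective i -> exists g : {linear Y -> E}, forall x, g (i x) = f x.

(* Main.v *)
(* Let e be a k-basis of A.  If E is injective, the embedding of E into the    *)
(* coinduced module Hom_k(A, E), x |-> (a |-> a x), has an A-linear            *)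
(* retraction; in coordinates it is a family of k-linear maps rho_p : E -> E   *)
(* with sum_p rho_p (e_p x) = x and b (rho_s x) = sum_p c_ps rho_p x whenever  *)
(* e_p b = sum_s c_ps e_s.  Such data for E1 and E2 tensor to such data for    *)
(* E1 ⊗ E2 over A^e.  Conversely they make E injective: a linear map f on a    *)
(* submodule X of Y extends k-linearly to some h on Y, and                     *)
(* y |-> sum_p rho_p (h (e_p y)) is a linear extension of f.                   *)

Require Import Defs.
From mathcomp Require Import all_boot all_order all_algebra.
From HB Require Import structures.
From mathcomp Require Import boolp classical_sets.

Set Implicit Arguments.
Unset Strict Implicit.
Unset Printing Implicit Defensive.

Import GRing.Theory.
Local Open Scope ring_scope.

(** Coinduction from [k] is right adjoint to restriction of scalars, which preserves injections, and
    vector spaces are injective ([vector_space_injective]); hence a summand of a coinduced module is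
    injective ([coinduced_split_injective]). Conversely, an injective module splits off its own
    coinduction, and over a finite-dimensional algebra the splitting has finitely many coordinates
    ([finite_dimensional_coinduced_split]). Such splittings for [E1] over [A] and [E2] over [B]
    multiply to one for their tensor product ([tensor_coinduced_split]); the theorem is the case
    where [B] is [A^c]. *)

(** * Extension of linear maps over a field *)

Lemma linear_bundle (R : pzRingType) (V W : lmodType R) (f : V -> W) :
  linear f -> exists g : {linear V -> W}, g =1 f.
Proof.
move=> linf; pose fL := GRing.isLinear.Build _ _ _ _ f linf.
by exists (HB.pack f fL : {linear V -> W}).
Qed.

(* Zorn's lemma on graphs of partial linear maps extending f \o i^-1.  The    *)
(* empty graph is admitted so that the empty chain has an upper bound.        *)
Lemma vector_space_injective (k : fieldType) (V : lmodType k) :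
  injective_module V.
Proof.
move=> X Y i f inj_i.
(* For a subspace of [Y * V], being single-valued only has to be tested above 0. *)
pose graph (G : set (Y * V)) :=
  [/\ forall x, G (i x, f x),
      forall c p q, G p -> G q -> G (c *: p + q) &
      forall v, G (0, v) -> v = 0].
have [F FP totF|G [PG maxG]] :=
    @Zorn_bigcup _ (fun G : set (Y * V) => (forall p, ~ G p) \/ graph G).
  have [[p [G FG Gp]]|F0] := pselect (exists p, bigcup F id p); last first.
    by left=> p Fp; apply: F0; exists p.
  have FG_graph H q : F H -> H q -> graph H.
    by move=> FH Hq; case: (FP _ FH) => // /(_ q).
  right; split=> [x|c q r [H FH Hq] [K FK Kr]|v [H FH Hv]].
  - by exists G => //; have [] := FG_graph _ _ FG Gp.
  - have [HK|KH] := totF _ _ FH FK.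
      by exists K => //; have [_ + _] := FG_graph _ _ FK Kr; apply=> //; apply: HK.
    by exists H => //; have [_ + _] := FG_graph _ _ FH Hq; apply=> //; apply: KH.
  - by have [_ _] := FG_graph _ _ FH Hv; apply.
have [baseG subG funG] : graph G.
  (* A maximal [G] is not empty, since the graph of [f] along [i] is admissible; injectivity of [i]
     makes it single-valued. *)
  case: PG => // G0; exfalso; apply: (maxG (fun p => exists x, p = (i x, f x))).
    split=> [p /G0 //|eqG].
    by apply: (G0 (i 0, f 0)); apply: eqG; exists 0.
  right; split=> [x|c _ _ [x ->] [x' ->]|v [x [ix0 ->]]]; first by exists x.
    by exists (c *: x + x'); rewrite !linearP.
  by rewrite (_ : x = 0) ?raddf0 //; apply: inj_i; rewrite raddf0.
have G0 : G 0 by have := baseG 0; rewrite !raddf0.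
have GZ c p : G p -> G (c *: p) by move=> Gp; rewrite -[_ *: _]addr0; apply: subG.
have GD p q : G p -> G q -> G (p + q).
  by move=> Gp Gq; rewrite -[p]scale1r; apply: subG.
have totG y : exists v, G (y, v).
  apply: contrapT => Gy.
  (* If [y] is outside the domain, adding the line through [(y, 0)] gives a strictly larger graph,
     against maximality. *)
  apply: (maxG (fun p => exists c q, G q /\ p = q + c *: (y, 0))).
    split=> [p Gp|eqG]; first by exists 0, p; rewrite scale0r addr0.
    apply: Gy; exists 0; apply: eqG; exists 1, 0.
    by rewrite scale1r add0r.
  right; split.
  - by move=> x; exists 0, (i x, f x); rewrite scale0r addr0.
  - move=> d _ _ [c [p [Gp ->]]] [c' [p' [Gp' ->]]].
    exists (d * c + c'), (d *: p + p'); split; first exact: subG.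
    by rewrite scalerDr scalerDl addrACA scalerA.
  - move=> v [c [[q1 q2] [Gq [q10 ->]]]]; rewrite /= scaler0 addr0.
    have [c0|c0] := eqVneq c 0.
      by apply: funG; move: q10 Gq; rewrite c0 scale0r addr0 => ->.
    (* A nonzero [c] can be inverted, which puts [y] in the domain already. *)
    exfalso; apply: Gy; exists (- c^-1 *: q2).
    have -> : y = - c^-1 *: q1; last exact: (GZ _ (q1, q2)).
    move/esym/eqP: q10; rewrite addr_eq0 => /eqP ->.
    by rewrite scalerN scaleNr opprK scalerA mulVf ?scale1r.
have {totG} [h Gh] := choice totG.
have hE y v : G (y, v) -> h y = v.
  move=> Gyv; apply/eqP; rewrite -subr_eq0; apply/eqP/funG.
  by have := GD _ _ (Gh y) (GZ (-1) _ Gyv); rewrite scaleN1r -[_ + _]/(_, _) subrr.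
have hlin : linear h.
  by move=> c y y'; apply: hE; apply: (subG c (y, h y) (y', h y')).
have [hL hLE] := linear_bundle hlin.
by exists hL => x; rewrite hLE; apply: hE.
Qed.

(** * Splittings of the embedding into the coinduced module *)

Section Coefficients.
Variables (k : fieldType) (R : kalgType k).

(* When e is a basis of R: an R-linear retraction of the embedding            *)
(* x |-> (a |-> a x) of E into Hom_k(R, E), in coordinates.                   *)
Definition coinduced_split (E : lmodType R) : Prop :=
  exists (I : finType) (e : I -> R)
         (rho : I -> {linear kspace R E -> kspace R E}),
    (forall x : E, \sum_p (rho p (e p *: x) : E) = x) /\
    forall b, exists c : I -> I -> k,
      (forall p, e p * b = \sum_s alg_scalar R (c p s) * e s) /\
      (forall s (x : E),
         b *: (rho s x : E) = \sum_p alg_scalar R (c p s) *: (rho p x : E)).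

Lemma restrict_scalars_linear (X Y : lmodType R) (f : {linear X -> Y}) :
  exists g : {linear kspace R X -> kspace R Y}, forall x : X, g x = f x.
Proof.
pose g : kspace R X -> kspace R Y := f.
have ling : linear g by move=> c x y; apply: (linearP f (alg_scalar R c)).
by have [gL gLE] := linear_bundle ling; exists gL.
Qed.

(** The sum $\sum_p \rho_p(h(e_p y))$ is [R]-linear although [h] is only [k]-linear: replacing [y]
    by [b y] and applying [b] outside both give $\sum_{p,s} c_{ps}\rho_p(h(e_s y))$. *)
Lemma coinduced_split_injective (E : lmodType R) :
  coinduced_split E -> injective_module E.
Proof.
move=> [I [e [rho [rho_e rho_b]]]] X Y i f inj_i.
have [ik ikE] := restrict_scalars_linear i.
have [fk fkE] := restrict_scalars_linear f.
have inj_ik : injective ik by move=> x y; rewrite !ikE; apply: inj_i.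
have [h hik] := vector_space_injective fk inj_ik.
pose g (y : Y) : E := \sum_p rho p (h (e p *: y)).
have gD y y' : g (y + y') = g y + g y'.
  rewrite /g -big_split; apply: eq_bigr => p _ /=; rewrite scalerDr.
  by rewrite -[LHS]/(rho p (h ((e p *: y : kspace R Y) + e p *: y'))) !raddfD.
have gZ b y : g (b *: y) = b *: g y.
  have [c [e_b rhoc]] := rho_b b.
  rewrite /g scaler_sumr; under [RHS]eq_bigr do rewrite rhoc.
  rewrite exchange_big; apply: eq_bigr => p _ /=.
  have -> : e p *: (b *: y) = \sum_s c p s *: (e s *: y : kspace R Y).
    rewrite scalerA e_b scaler_suml; apply: eq_bigr => s _.
    by rewrite -scalerA.
  rewrite !linear_sum; apply: eq_bigr => s _.
  by rewrite !linearZ.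
have ling : linear g by move=> b y y'; rewrite gD gZ.
have [gL gLE] := linear_bundle ling; exists gL => x; rewrite gLE /g.
rewrite -[RHS]rho_e; apply: eq_bigr => p _.
by rewrite -linearZ -[h _]/(h (i _ : kspace R Y)) -ikE hik fkE linearZ.
Qed.

Variables (n : nat) (e : 'I_n -> R) (M : {rmorphism R -> 'M[k]_n}).

(* Hom_k(R, E) in coordinates: phi p stands for phi (e p), and (b phi) a is   *)
(* phi (a b).                                                                 *)
Definition coinduced (N : {rmorphism R -> 'M[k]_n}) (E : lmodType R) : Type :=
  {ffun 'I_n -> E}.

Section CoinducedModule.
Variable E : lmodType R.

HB.instance Definition _ := GRing.Zmodule.on (coinduced M E).

Definition coinduced_scale (b : R) (phi : coinduced M E) : coinduced M E :=
  [ffun p => \sum_s alg_scalar R (M b p s) *: (phi s : E)].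

(** [M b] stands for right multiplication by [b] on row coordinates, so its multiplicativity in this
    order yields a left action. *)
Fact coinduced_scaleA a b phi :
  coinduced_scale a (coinduced_scale b phi) = coinduced_scale (a * b) phi.
Proof.
apply/ffunP => p; rewrite !ffunE.
under eq_bigr do rewrite ffunE scaler_sumr.
rewrite exchange_big; apply: eq_bigr => s _.
rewrite rmorphM mxE rmorph_sum scaler_suml; apply: eq_bigr => t _.
by rewrite scalerA rmorphM.
Qed.

Fact coinduced_scale1 : left_id 1 coinduced_scale.
Proof.
move=> phi; apply/ffunP => p; rewrite !ffunE rmorph1 (bigD1 p) //=.
rewrite mxE eqxx rmorph1 scale1r big1 ?addr0 // => s /negbTE.
by rewrite mxE eq_sym => ->; rewrite rmorph0 scale0r.
Qed.

Fact coinduced_scaleDr : right_distributive coinduced_scale +%R.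
Proof.
move=> b phi psi; apply/ffunP => p; rewrite !ffunE -big_split.
by apply: eq_bigr => s _; rewrite ffunE scalerDr.
Qed.

Fact coinduced_scaleDl phi : {morph coinduced_scale^~ phi : a b / a + b}.
Proof.
move=> a b; apply/ffunP => p; rewrite !ffunE -big_split.
by apply: eq_bigr => s _; rewrite rmorphD mxE rmorphD scalerDl.
Qed.

HB.instance Definition _ := GRing.Zmodule_isLmodule.Build R (coinduced M E)
  coinduced_scaleA coinduced_scale1 coinduced_scaleDr coinduced_scaleDl.

End CoinducedModule.

Hypothesis mul_e : forall p b, e p * b = \sum_s alg_scalar R (M b p s) * e s.
Hypothesis M_scalar : forall c, M (alg_scalar R c) = c%:M.
Hypothesis span1 : exists d : 'I_n -> k, 1 = \sum_s alg_scalar R (d s) * e s.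

(** Injectivity applied to the identity of [E] gives a retraction [r] of [iota], and [rho p] is [r]
    restricted to the p-th coordinate. The first identity is then [r (iota x) = x], the second is
    the [R]-linearity of [r]. *)
Lemma injective_coinduced_split (E : lmodType R) :
  injective_module E -> coinduced_split E.
Proof.
move=> injE.
pose iota (x : E) : coinduced M E := [ffun p => e p *: x].
have iota_lin : linear iota.
  move=> b x y; apply/ffunP => p; rewrite !ffunE scalerDr scalerA mul_e.
  congr (_ + _); rewrite scaler_suml; apply: eq_bigr => s _.
  by rewrite ffunE scalerA.
have [i iE] := linear_bundle iota_lin.
have inj_i : injective i.
  (* As 1 is a combination of the [e s], the values [e s *: x] determine [x]. *)
  move=> x y; rewrite !iE => /ffunP eqxy; have [d d1] := span1.
  rewrite -[x]scale1r -[y]scale1r d1 !scaler_suml; apply: eq_bigr => s _.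
  by have := eqxy s; rewrite !ffunE -!scalerA => ->.
have [r rK] := injE _ _ i (idfun : {linear E -> E}) inj_i.
pose delta p (x : E) : coinduced M E := [ffun s => if s == p then x else 0].
have deltaD p : {morph delta p : x y / x + y}.
  by move=> x y; apply/ffunP => s; rewrite !ffunE; case: eqP; rewrite ?addr0.
(* Only the p-th column of [M b] meets a vector supported at [p]. *)
have scale_delta b p x :
    b *: delta p x = \sum_s delta s (alg_scalar R (M b s p) *: x).
  apply/ffunP => s; rewrite sum_ffunE ffunE (bigD1 p) //= [RHS](bigD1 s) //=.
  rewrite !ffunE !eqxx !big1 // => t /negbTE nt; rewrite ffunE.
    by rewrite eq_sym nt.
  by rewrite nt scaler0.
have delta_scalar c p x :
    delta p (alg_scalar R c *: x) = alg_scalar R c *: delta p x.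
  rewrite scale_delta M_scalar (bigD1 p) //= mxE eqxx mulr1n big1 ?addr0 //.
  move=> s /negbTE ns; rewrite mxE ns rmorph0 scale0r.
  by apply/ffunP => t; rewrite !ffunE if_same.
have rho_lin p : linear (fun x : kspace R E => r (delta p x) : kspace R E).
  move=> c x y.
  by rewrite kspace_scaleE -[LHS]/(r (delta p (_ + _))) deltaD delta_scalar linearP.
have /choice [rho rhoE] p := linear_bundle (rho_lin p).
exists 'I_n, e, rho; split=> [x|b].
  rewrite -[RHS]rK iE; under eq_bigr do rewrite rhoE.
  rewrite -linear_sum; congr (r _); apply/ffunP => s.
  rewrite sum_ffunE ffunE (bigD1 s) //= big1 ?addr0 ?ffunE ?eqxx //.
  by move=> t /negbTE nt; rewrite ffunE eq_sym nt.
exists (M b); split=> [p|s x]; first exact: mul_e.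
rewrite rhoE -linearZ_LR scale_delta linear_sum; apply: eq_bigr => p _.
by rewrite rhoE delta_scalar linearZ_LR.
Qed.

End Coefficients.

(** * Bases of a finite-dimensional algebra and of its opposite *)

Lemma finite_dimensional_coinduced_split (k : fieldType) (A : kalgType k)
    (E : lmodType A) :
  finite_dimensional (kspace A A^o) -> injective_module E -> coinduced_split E.
Proof.
move=> [n [f [g fK gK]]].
pose e p : A := g (delta_mx 0 p).
have expand (a : A) : a = \sum_s alg_scalar A (f a 0 s) * e s.
  apply: (can_inj fK); rewrite [LHS]row_sum_delta.
  rewrite -[RHS]/(f (\sum_s f a 0 s *: (e s : kspace A A^o))) linear_sum.
  by apply: eq_bigr => s _; rewrite linearZ /= gK.
(* The matrix of right multiplication by [b] in the basis [e], with row p holding the coordinates of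
   [e p * b]. *)
pose M (b : A) : 'M[k]_n := \matrix_(p, s) f (e p * b) 0 s.
have MB : zmod_morphism M.
  move=> a b; apply/matrixP => p s; rewrite !mxE mulrBr.
  by rewrite (raddfB f (e p * a) (e p * b)) !mxE.
have f_alg c (a : A) : f (alg_scalar A c * a) = c *: f a.
  exact: (linearZ_LR f).
have f_sum (F : 'I_n -> A) : f (\sum_s F s) = \sum_s f (F s).
  exact: (raddf_sum f).
have M_scalar c : M (alg_scalar A c) = c%:M.
  apply/matrixP => p s; rewrite !mxE -alg_scalarC f_alg /e gK !mxE eqxx /=.
  by rewrite eq_sym mulr_natr.
have M1 : M 1 = 1 by rewrite -(rmorph1 (alg_scalar A)) M_scalar.
have fM (a b : A) : f (a * b) = f a *m M b.
  rewrite {1}(expand a) mulr_suml f_sum; apply/rowP => s.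
  rewrite summxE mxE; apply: eq_bigr => p _.
  by rewrite -mulrA f_alg !mxE.
have MM : {morph M : a b / a * b}.
  move=> a b; apply/matrixP => p s.
  rewrite !mxE mulrA fM mxE; apply: eq_bigr => t _.
  by rewrite !mxE.
pose Mzm := GRing.isZmodMorphism.Build A 'M[k]_n M MB.
pose Mmm := GRing.isMonoidMorphism.Build A 'M[k]_n M (conj M1 MM).
pose Mr : {rmorphism A -> 'M[k]_n} := HB.pack M Mzm Mmm.
apply: (@injective_coinduced_split k A n e Mr).
- by move=> p b; rewrite [LHS]expand; apply: eq_bigr => s _; rewrite mxE.
- exact: M_scalar.
- by exists (f 1 0); apply: expand.
Qed.

(** The same coordinate map serves, because scalars are central. *)
Lemma finite_dimensional_opp (k : fieldType) (A : kalgType k) :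
  finite_dimensional (kspace A A^o) ->
  finite_dimensional (kspace (A^c)%type ((A^c)%type)^o).
Proof.
move=> [n [f bij_f]].
pose f' : kspace (A^c)%type ((A^c)%type)^o -> 'rV[k]_n := f.
have linf' : linear f'.
  move=> c x y; rewrite /f' -(linearP f c x y); congr (f (_ + _)).
  exact: (esym (alg_scalarC c (x : A))).
have [g gE] := linear_bundle linf'.
by exists n, g; apply: eq_bij bij_f _ _ => x; rewrite gE.
Qed.

(** * Tensor products of splittings *)

Section TensorCombinations.
Variables (k : fieldType) (A B : kalgType k).
Variables (E1 : lmodType A) (E2 : lmodType B).

Lemma mpure_suml (I : finType) (F : I -> E1) (y : E2) :
  mpure (\sum_i F i) y = \sum_i mpure (F i) y.
Proof.
elim/big_ind2: _ => [|x u x' u' <- <-|//].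
  exact: (@pure0l k (kspace A E1) (kspace B E2)).
exact: (@pureDl k (kspace A E1) (kspace B E2)).
Qed.

Lemma mpure_sumr (I : finType) (x : E1) (F : I -> E2) :
  mpure x (\sum_i F i) = \sum_i mpure x (F i).
Proof.
elim/big_ind2: _ => [|y u y' u' <- <-|//].
  exact: (@pure0r k (kspace A E1) (kspace B E2)).
exact: (@pureDr k (kspace A E1) (kspace B E2)).
Qed.

(** Scalars of the tensor algebra sit in the left factor, so [d] is moved across the tensor sign. *)
Lemma mpure_scalar2 (c d : k) (x : E1) (y : E2) :
  mpure (alg_scalar A c *: x) (alg_scalar B d *: y) =
  alg_scalar (tensor_alg A B) (c * d) *: mpure x y.
Proof.
rewrite -[alg_scalar (tensor_alg A B) _]/(apure (alg_scalar A (c * d)) 1).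
rewrite scale_mpure scale1r.
rewrite mulrC rmorphM -scalerA.
exact/esym/(@pureZ k (kspace A E1) (kspace B E2)).
Qed.

Lemma mpure_lincomb (I J : finType) (c : I -> k) (d : J -> k)
    (x : I -> E1) (y : J -> E2) :
  mpure (\sum_i alg_scalar A (c i) *: x i) (\sum_j alg_scalar B (d j) *: y j) =
  \sum_(p : I * J) alg_scalar (tensor_alg A B) (c p.1 * d p.2) *:
    mpure (x p.1) (y p.2).
Proof.
rewrite mpure_suml; under eq_bigr do rewrite mpure_sumr.
by rewrite pair_bigA; apply: eq_bigr => p _; rewrite mpure_scalar2.
Qed.

End TensorCombinations.

Lemma apure_lincomb (k : fieldType) (A B : kalgType k) (I J : finType)
    (c : I -> k) (d : J -> k) (x : I -> A) (y : J -> B) :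
  apure (\sum_i alg_scalar A (c i) * x i) (\sum_j alg_scalar B (d j) * y j) =
  \sum_(p : I * J) alg_scalar (tensor_alg A B) (c p.1 * d p.2) *
    apure (x p.1) (y p.2).
Proof. exact: (@mpure_lincomb k A B A^o B^o). Qed.

Section TensorSplit.
Variables (k : fieldType) (A B : kalgType k).
Variables (E1 : lmodType A) (E2 : lmodType B).

Lemma tensor_map_linear (r1 : {linear kspace A E1 -> kspace A E1})
    (r2 : {linear kspace B E2 -> kspace B E2}) :
  exists r : {linear kspace (tensor_alg A B) (tensor_module E1 E2) ->
                     kspace (tensor_alg A B) (tensor_module E1 E2)},
    forall (x : E1) (y : E2), r (mpure x y) = mpure (r1 x : E1) (r2 y : E2).
Proof.
pose F x y : tensor_module E1 E2 := mpure (r1 x : E1) (r2 y : E2).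
have balF : @balanced k (kspace A E1) (kspace B E2) _ F.
  split=> [y|x x' y|x y y'|c x y]; rewrite /F.
  - by rewrite raddf0; apply: (@pure0l k (kspace A E1) (kspace B E2)).
  - by rewrite raddfD; apply: (@pureDl k (kspace A E1) (kspace B E2)).
  - by rewrite raddfD; apply: (@pureDr k (kspace A E1) (kspace B E2)).
  - by rewrite !linearZ; apply: (@pureZ k (kspace A E1) (kspace B E2)).
pose r (u : kspace (tensor_alg A B) (tensor_module E1 E2)) :
  kspace (tensor_alg A B) (tensor_module E1 E2) := tensor_lift F u.
have rD u v : r (u + v) = r u + r v by apply: tensor_liftD balF.
have r0 : r 0 = 0 by apply: tensor_lift0 balF.
have r_pure x y : r (mpure x y) = F x y by apply: tensor_lift_pure balF.
have rZ c u : r (c *: u) = c *: r u.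
  elim/tensor_module_ind: u => [|x y|u v IHu IHv].
  - by rewrite scaler0 r0 scaler0.
  - rewrite r_pure !kspace_scaleE.
    rewrite -[alg_scalar (tensor_alg A B) _]/(apure (alg_scalar A c) 1).
    rewrite !scale_mpure !scale1r.
    by rewrite r_pure /F -[alg_scalar A c *: x]/(c *: (x : kspace A E1)) linearZ.
  - by rewrite scalerDr !rD scalerDr IHu IHv.
have linr : linear r by move=> c u v; rewrite rD rZ.
by have [rL rLE] := linear_bundle linr; exists rL => x y; rewrite rLE r_pure.
Qed.

(** Take the products of the [e1] and [e2] and the tensor products of the [r1] and [r2]. The second
    condition is additive in the ring element, so pure tensors suffice. *)
Lemma tensor_coinduced_split :
  coinduced_split E1 -> coinduced_split E2 ->
  coinduced_split (tensor_module E1 E2 : lmodType (tensor_alg A B)).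
Proof.
move=> [I1 [e1 [r1 [r1e r1b]]]] [I2 [e2 [r2 [r2e r2b]]]].
have /choice [r rE] (p : I1 * I2) := tensor_map_linear (r1 p.1) (r2 p.2).
exists (I1 * I2)%type, (fun p => apure (e1 p.1) (e2 p.2)), r; split.
  elim/tensor_module_ind=> [|x y|u v IHu IHv].
  - by rewrite big1 // => p _; rewrite scaler0 raddf0.
  - under eq_bigr do rewrite scale_mpure rE.
    rewrite -(pair_bigA _ (fun i j =>
      mpure (r1 i (e1 i *: x) : E1) (r2 j (e2 j *: y) : E2))) /=.
    under eq_bigr do rewrite -mpure_sumr r2e.
    by rewrite -mpure_suml r1e.
  - rewrite -[RHS]/(u + v) -{2}IHu -{2}IHv -big_split; apply: eq_bigr => p _.
    by rewrite scalerDr; apply: (raddfD (r p)).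
elim/tensor_alg_ind=> [|a b|b b' [c [cE cr]] [c' [cE' cr']]].
- exists (fun _ _ => 0); split=> [p|s x].
    by rewrite mulr0 big1 // => s _; rewrite rmorph0 mul0r.
  by rewrite scale0r big1 // => p _; rewrite rmorph0 scale0r.
- have [c1 [c1e c1r]] := r1b a; have [c2 [c2e c2r]] := r2b b.
  (* The Kronecker product of the two coefficient matrices. *)
  exists (fun p s => c1 p.1 s.1 * c2 p.2 s.2); split=> [p|s u].
    by rewrite apureM c1e c2e apure_lincomb.
  elim/tensor_module_ind: u => [|x y|u v IHu IHv].
  + by rewrite raddf0 scaler0 big1 // => p _; rewrite raddf0 scaler0.
  + rewrite rE scale_mpure c1r c2r mpure_lincomb.
    by apply: eq_bigr => p _; rewrite rE.
  + rewrite (raddfD (r s) u v) scalerDr IHu IHv -big_split.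
    by apply: eq_bigr => p _; rewrite (raddfD (r p) u v) scalerDr.
- exists (fun p s => c p s + c' p s); split=> [p|s x].
    rewrite mulrDr cE cE' -big_split; apply: eq_bigr => s _.
    by rewrite rmorphD mulrDl.
  rewrite scalerDl cr cr' -big_split; apply: eq_bigr => p _.
  by rewrite rmorphD scalerDl.
Qed.

End TensorSplit.

Theorem proposition3p2 (k : fieldType) (A : kalgType k)
    (finA : finite_dimensional (kspace A A^o))
    (E1 : lmodType A) (E2 : rmodType A) :
  injective_module E1 -> injective_module E2 ->
  injective_module (tensor_module E1 E2 : lmodType (enveloping A)).
Proof.
move=> inj1 inj2; apply: coinduced_split_injective.
apply: tensor_coinduced_split.
  exact: finite_dimensional_coinduced_split.
apply: finite_dimensional_coinduced_split inj2.
exact: finite_dimensional_opp.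
Qed.
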